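(* Let $N\in\mathbb{N}$ be even, let $\pi$ be a symmetric, bi-monotone permutation of $\{1,\dots,N\}$ with $I_\pi^0=\emptyset$, and let $S_\pi$ denote the corresponding shuffle. Then the copula $C_{S_\pi}$ is a diagonal copula, i.e. $C_{S_\pi}=E_\delta$ for some $\delta\in\mathcal{D}$.
   Context: $\lambda$ denotes Lebesgue measure on $[0,1]$. $\mathcal{D}$ is the set of diagonals of bivariate copulas, i.e. of all functions $\delta:[0,1]\to[0,1]$ with $\delta(0)=0$, $\delta(1)=1$, $\delta$ non-decreasing, $\delta$ Lipschitz with constant $2$, and $\delta(t)\le t$ for all $t$. For $\delta\in\mathcal{D}$ the diagonal copula $E_\delta$ is $$E_\delta(u,v)=\min\Bigl\{u,v,\tfrac{\delta(u)+\delta(v)}{2}\Bigr\},\quad u,v\in[0,1].$$ For a permutation $\pi$ of $\{1,\dots,N\}$, the equidistant even shuffle $S_\pi:[0,1]\to[0,1]$ is given by $S_\pi(x)=x-\frac{i-\pi(i)}{N}$ for $x\in(\frac{i-1}{N},\frac iN)$, $i=1,\dots,N$ (values at grid points are irrelevant), and its copula is $C_{S_\pi}(u,v)=\lambda(\{x\in[0,u]:S_\pi(x)\le v\})$. The permutation $\pi$ is called symmetric if $\pi\circ\pi=\mathrm{id}$. Put $I_\pi^-:=\{i:\pi(i)<i\}$ and $I_\pi^0:=\{i:\pi(i)=i\}$. $\pi$ is called bi-monotone if its restriction to $I_\pi^-$ is strictly increasing. *)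

(* Defs.v *)
From mathcomp Require Import all_boot all_order all_algebra all_fingroup.
From mathcomp Require Import all_classical all_reals all_analysis.

Set Implicit Arguments.
Unset Strict Implicit.
Unset Printing Implicit Defensive.

Import Order.TTheory GRing.Theory Num.Theory.
Import numFieldNormedType.Exports.

Local Open Scope classical_set_scope.
Local Open Scope ring_scope.

(* Functions on [0,1] are represented by total functions R -> R of which only
   the values on [0,1] are constrained or used. *)
Record is_diagonal (R : realType) (delta : R -> R) : Prop := IsDiagonal {
  diagonal_itv : forall t : R, t \in `[0, 1] -> delta t \in `[0, 1];
  diagonal0 : delta 0 = 0;
  diagonal1 : delta 1 = 1;
  diagonal_nd : {in `[0, 1] &, nondecreasing_fun delta};
  diagonal_lip : 2.-lipschitz_(`[0, 1]) delta;
  diagonal_le : forall t : R, t \in `[0, 1] -> delta t <= t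
}.

Definition diagonal_copula (R : realType) (delta : R -> R) (u v : R) : R :=
  Num.min u (Num.min v ((delta u + delta v) / 2)).

Definition is_diagonal_copula (R : realType) (C : R -> R -> \bar R) : Prop :=
  exists2 delta : R -> R, is_diagonal delta &
    forall u v : R, u \in `[0, 1] -> v \in `[0, 1] ->
      C u v = (diagonal_copula delta u v)%:E.

(* Indices run over 0, ..., N-1, so the cell of i is ]i/N, (i+1)/N[; the shift
   i - p(i) is unaffected by this renumbering.  The values of S at the grid
   points are left free in [0,1]. *)
Definition is_shuffle (R : realType) (N : nat) (p : 'S_N) (S : R -> R) : Prop :=
  (forall x : R, x \in `[0, 1] -> S x \in `[0, 1]) /\
  (forall (i : 'I_N) (x : R), x \in `]i%:R / N%:R, i.+1%:R / N%:R[ ->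
     S x = x - (i%:R - (p i)%:R) / N%:R).

Definition shuffle_copula (R : realType) (S : R -> R) (u v : R) : \bar R :=
  lebesgue_measure [set x : R | x \in `[0, u] /\ S x <= v].

Definition symmetric_perm (N : nat) (p : 'S_N) : Prop := involutive p.

Definition I_minus (N : nat) (p : 'S_N) : {set 'I_N} :=
  [set i : 'I_N | (p i < i)%N]%SET.

Definition I_zero (N : nat) (p : 'S_N) : {set 'I_N} :=
  [set i : 'I_N | p i == i]%SET.

Definition bi_monotone (N : nat) (p : 'S_N) : Prop :=
  {in I_minus p &, forall i j : 'I_N, (i < j)%N -> (p i < p j)%N}.

(* Main.v *)
Require Import Defs.
From mathcomp Require Import all_boot all_order all_algebra all_fingroup.
From mathcomp Require Import all_classical all_reals all_analysis.
From mathcomp Require Import lra.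

(** For t in [0,1] let f_t(i) be the length of [0,t] inside the i-th cell
    ]i/N, (i+1)/N[.  The sequence f_t is a full block of entries 1/N, then at
    most one partial entry, then zeros, and it sums to t.  The shuffle
    translates the cell i onto the cell p(i), so the points x <= u of the cell
    i with S(x) <= v form an initial segment of that cell, of length
    min(f_u(i), f_v(p(i))) ([measure_initial_part], [initial_part_min]).  The
    grid points are a null set, so the copula of the shuffle is the finite sum
    C(u,v) = sum_i min(f_u(i), f_v(p(i))) ([shuffle_copula_mass]), and the rest
    is combinatorics.

    As p is an involution, C is symmetric and we may take u <= v; as p has no
    fixed point, the indices split into M = I_minus and p(M).  For j in M,
    p(j) < j gives f_u(j) <= f_v(p(j)), so
    C(u,v) = sum_(j in M) (f_u(j) + min(f_u(p(j)), f_v(j))).  On the diagonal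
    this is delta(t) = 2 sum_(j in M) f_t(j), so diagonality of C amounts to
    the sum of the minima being the minimum of the two sums: the first one
    gives u (the f_u(j) and f_u(p(j)) exhaust all cells), the second one gives
    (delta(u) + delta(v))/2.  This exchange holds because j |-> f_u(p(j)) and
    j |-> f_v(j) are comparable on the whole of M ([cell_part_comparable]): by
    bi-monotonicity both have, along M, the shape full, partial, zero, and two
    such sequences are always ordered.

    That delta is a diagonal follows from f_t(i) being nondecreasing in t: the
    increment of the sum over M is at most that of the sum over all cells, which
    is the increment of t; and delta(t) <= t because f_t(j) <= f_t(p(j)) on
    M. *)

Set Implicit Arguments.
Unset Strict Implicit.
Unset Printing Implicit Defensive.

Import Order.TTheory GRing.Theory Num.Theory.
Import numFieldNormedType.Exports.

Local Open Scope classical_set_scope.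
Local Open Scope ring_scope.

(** * The length of an initial interval inside a grid cell *)

Definition grid (R : realType) (N i : nat) : R := i%:R / N%:R.

Lemma gridS (R : realType) (N i : nat) : grid R N i.+1 = grid R N i + N%:R^-1.
Proof. by rewrite /grid -addn1 natrD mulrDl mul1r. Qed.

Lemma invN_gt0 (R : realType) (N : nat) : (0 < N)%N -> 0 < N%:R^-1 :> R.
Proof. by move=> N_gt0; rewrite invr_gt0 ltr0n. Qed.

Lemma gridS_le (R : realType) (N i j : nat) :
  (i < j)%N -> grid R N i.+1 <= grid R N j.
Proof. by move=> ij; rewrite ler_wpM2r ?invr_ge0 // ler_nat. Qed.

(** A difference of truncations, which telescopes over the cells. *)
Definition cell_part (R : realType) (N : nat) (t : R) (i : nat) : R :=
  Num.min t (grid R N i.+1) - Num.min t (grid R N i).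

(** Comparisons are decided innermost first, so that no hypothesis is left with
    an undecided conditional in it. *)
Ltac minmax := rewrite ?minEle ?maxEle;
  repeat match goal with |- context [if ?a <= ?b then _ else _] =>
    lazymatch constr:((a, b)) with
    | context [if _ then _ else _] => fail
    | _ => case: (leP a b) => ?
    end end.

Section CellPart.
Context {R : realType} {N : nat} (N_gt0 : (0 < N)%N).
Implicit Types (s t : R) (i j : nat).

Lemma cell_part_ge0 t i : 0 <= cell_part N t i.
Proof.
by rewrite /cell_part gridS; have := invN_gt0 R N_gt0; minmax; lra.
Qed.

Lemma cell_part_le t i : cell_part N t i <= N%:R^-1.
Proof.
by rewrite /cell_part gridS; have := invN_gt0 R N_gt0; minmax; lra.
Qed.

Lemma cell_part_nd s t i : s <= t -> cell_part N s i <= cell_part N t i.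
Proof.
by rewrite /cell_part gridS => st; have := invN_gt0 R N_gt0; minmax; lra.
Qed.

(** At most one cell is partially covered. *)
Lemma cell_part_full_or_zero t i j : (i < j)%N ->
  cell_part N t i = N%:R^-1 \/ cell_part N t j = 0.
Proof.
move=> /(gridS_le R N); rewrite /cell_part !gridS => ij.
have := invN_gt0 R N_gt0.
case: (leP (grid R N i + N%:R^-1) t) => ti; [left|right]; minmax; lra.
Qed.

Lemma cell_part_ni t i j : (i < j)%N -> cell_part N t j <= cell_part N t i.
Proof.
case/(cell_part_full_or_zero t) => ->; first exact: cell_part_le.
exact: cell_part_ge0.
Qed.

Lemma sum_cell_part t : t \in `[0, 1] -> \sum_(i < N) cell_part N t i = t.
Proof.
rewrite in_itv /= => /andP[t0 t1].
rewrite -(big_mkord xpredT) telescope_sumr //.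
have N0 : N%:R != 0 :> R by rewrite pnatr_eq0 -lt0n.
by rewrite /grid mul0r divff // (min_idPl t1) (min_idPr t0) subr0.
Qed.

Lemma cell_part1 i : (i < N)%N -> cell_part N (1 : R) i = N%:R^-1.
Proof.
move=> /(gridS_le R N); rewrite /cell_part gridS.
have -> : grid R N N = 1 by rewrite /grid divff // pnatr_eq0 -lt0n.
by have := invN_gt0 R N_gt0; minmax; lra.
Qed.

End CellPart.

(** * The combinatorics of the involution *)

(** In general the left side is only the smaller one; comparability of the
    families makes one of them realize all the minima at once. *)
Lemma sum_min_comparable (R : realType) (I : finType) (A : {set I})
    (a b : I -> R) :
  (forall i, i \in A -> a i <= b i) \/ (forall i, i \in A -> b i <= a i) ->
  \sum_(i in A) Num.min (a i) (b i) =
  Num.min (\sum_(i in A) a i) (\sum_(i in A) b i).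
Proof.
case=> ab.
- by rewrite (min_idPl (ler_sum _ ab)); apply: eq_bigr => i /ab /min_idPl.
- by rewrite (min_idPr (ler_sum _ ab)); apply: eq_bigr => i /ab /min_idPr.
Qed.

Section Involution.
Context {R : realType} {N : nat} (N_gt0 : (0 < N)%N) (p : 'S_N).
Context (p_sym : symmetric_perm p) (p_bimon : bi_monotone p).
Context (p_I0 : I_zero p = finset.set0).
Implicit Types (u v s t : R).

Let M := I_minus p.

Lemma image_I_minus (i : 'I_N) : (p i \in M) = (i \notin M).
Proof.
have pi_neq : (p i == i) = false.
  by have := finset.in_set0 i; rewrite -p_I0 inE.
rewrite !inE p_sym -leqNgt [in RHS]leq_eqVlt eq_sym.
by have -> : (p i == i :> nat) = false by [].
Qed.

Lemma sum_I_minus (F : 'I_N -> R) :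
  \sum_(i < N) F i = \sum_(i in M) (F i + F (p i)).
Proof.
rewrite (bigID (mem M)) /= big_split /=; congr (_ + _).
rewrite (reindex_inj (@perm_inj _ p)) /=.
by apply: eq_bigl => i; rewrite image_I_minus negbK.
Qed.

Lemma cell_part_I_minus t j : j \in M -> cell_part N t j <= cell_part N t (p j).
Proof. by rewrite inE; apply: cell_part_ni. Qed.

(** Along M the families j |-> f_u(p j) and j |-> f_v(j) are both of the form
    full, partial, zero; if the first is smaller at some j, it vanishes after
    j, while the second is full before j. *)
Lemma cell_part_comparable u v :
  (forall j, j \in M -> cell_part N u (p j) <= cell_part N v j) \/
  (forall j, j \in M -> cell_part N v j <= cell_part N u (p j)).
Proof.
have [/exists_inP [j jM jlt]|/exists_inPn noj] :=
    boolP [exists (j | j \in M), cell_part N u (p j) < cell_part N v j].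
- left=> k kM; have [jk|kj|/val_inj <-] := ltngtP j k; last exact: ltW.
  + have [full|->] := cell_part_full_or_zero N_gt0 u (p_bimon jM kM jk).
      by have := cell_part_le N_gt0 v j; rewrite leNgt -full jlt.
    exact: cell_part_ge0.
  + have [->|zero] := cell_part_full_or_zero N_gt0 v kj.
      exact: cell_part_le.
    by have := cell_part_ge0 N_gt0 u (p j); rewrite leNgt -zero jlt.
- by right=> j /noj; rewrite -leNgt.
Qed.

Definition shuffle_mass u v : R :=
  \sum_(i < N) Num.min (cell_part N u i) (cell_part N v (p i)).

Definition shuffle_diagonal t : R := 2 * \sum_(i in M) cell_part N t i.

Lemma shuffle_mass_sym u v : shuffle_mass u v = shuffle_mass v u.
Proof.
rewrite /shuffle_mass (reindex_inj (@perm_inj _ p)) /=.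
by apply: eq_bigr => i _; rewrite p_sym minC.
Qed.

Lemma shuffle_mass_diagonal_le u v : u \in `[0, 1] -> u <= v ->
  shuffle_mass u v = diagonal_copula shuffle_diagonal u v.
Proof.
move=> u01 uv; rewrite /diagonal_copula /shuffle_mass sum_I_minus.
under eq_bigr => j jM.
  rewrite p_sym (min_idPl _); last first.
    apply: le_trans (cell_part_nd N_gt0 _ uv).
    exact: cell_part_I_minus.
  over.
rewrite big_split /= sum_min_comparable; last exact: cell_part_comparable.
rewrite minA (min_idPl uv) addr_minr -big_split /= -sum_I_minus sum_cell_part //.
by congr Num.min; rewrite /shuffle_diagonal -mulrDr mulrC mulKf.
Qed.

Lemma shuffle_mass_diagonal u v : u \in `[0, 1] -> v \in `[0, 1] ->
  shuffle_mass u v = diagonal_copula shuffle_diagonal u v.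
Proof.
move=> u01 v01; have [uv|/ltW vu] := leP u v.
  exact: shuffle_mass_diagonal_le.
rewrite shuffle_mass_sym shuffle_mass_diagonal_le //.
by rewrite /diagonal_copula minCA (addrC (_ v)).
Qed.

Lemma shuffle_diagonal_ge0 t : 0 <= shuffle_diagonal t.
Proof.
by rewrite mulr_ge0 // sumr_ge0 // => i _; apply: cell_part_ge0.
Qed.

(** Within each pair {j, p(j)} the earlier cell p(j) has the larger part, hence
    the sum over M is at most half of the total sum t. *)
Lemma shuffle_diagonal_le t : t \in `[0, 1] -> shuffle_diagonal t <= t.
Proof.
move=> t01; rewrite -[leRHS](sum_cell_part N_gt0 t01) sum_I_minus.
rewrite /shuffle_diagonal mulr_sumr ler_sum // => i iM.
by have := cell_part_I_minus t iM; lra.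
Qed.

Lemma shuffle_diagonal_nd s t : s <= t ->
  shuffle_diagonal s <= shuffle_diagonal t.
Proof.
move=> st; rewrite ler_pM2l // ler_sum // => i _; exact: cell_part_nd.
Qed.

(** The parts of all cells grow by nonnegative amounts that add up to t - s, and
    the diagonal counts twice those of the cells in M. *)
Lemma shuffle_diagonal_increment s t : s \in `[0, 1] -> t \in `[0, 1] ->
  s <= t -> shuffle_diagonal t - shuffle_diagonal s <= 2 * (t - s).
Proof.
move=> s01 t01 st; rewrite -mulrBr ler_pM2l // -sumrB.
rewrite -[in leRHS](sum_cell_part N_gt0 t01).
rewrite -[in leRHS](sum_cell_part N_gt0 s01) -sumrB [leRHS](bigID (mem M)) /= lerDl sumr_ge0 // => i _.
by rewrite subr_ge0; apply: cell_part_nd.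
Qed.

Lemma shuffle_diagonal1 : shuffle_diagonal 1 = 1.
Proof.
have t01 : (1 : R) \in `[0, 1] by rewrite in_itv /= ler01 lexx.
rewrite -[RHS](sum_cell_part N_gt0 t01) sum_I_minus /shuffle_diagonal mulr_sumr.
by apply: eq_bigr => i _; rewrite !cell_part1 // mulr_natl mulr2n.
Qed.

Lemma shuffle_diagonalP : is_diagonal shuffle_diagonal.
Proof.
split.
- move=> t t01; rewrite in_itv /= shuffle_diagonal_ge0 /=.
  by apply: le_trans (shuffle_diagonal_le t01) _; case/andP: t01.
- apply/eqP; rewrite eq_le shuffle_diagonal_ge0 andbT.
  by apply: shuffle_diagonal_le; rewrite in_itv /= lexx ler01.
- exact: shuffle_diagonal1.
- by move=> s t _ _; apply: shuffle_diagonal_nd.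
- move=> [s t] /= [s01 t01].
  have [st|/ltW ts] := leP s t.
  + rewrite distrC (distrC s) !ger0_norm ?subr_ge0 ?shuffle_diagonal_nd //.
    exact: shuffle_diagonal_increment.
  + rewrite !ger0_norm ?subr_ge0 ?shuffle_diagonal_nd //.
    exact: shuffle_diagonal_increment.
- exact: shuffle_diagonal_le.
Qed.

End Involution.

(** * The shuffle copula as a finite sum over cells *)

Lemma measure_initial_part (R : realType) (a b c : R) : a <= b ->
  lebesgue_measure [set x : R | a < x < b /\ x <= c] =
  (Num.max 0 (Num.min b c - a))%:E.
Proof.
move=> ab; have [bc|cb] := leP b c.
- have -> : [set x : R | a < x < b /\ x <= c] = [set` `]a, b[].
    apply/seteqP; split=> x /=; rewrite in_itv /=; first by case.
    by move=> /andP[-> xb]; split=> //; apply: le_trans bc; apply: ltW.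
  rewrite lebesgue_measure_itv /= lte_fin EFinN -EFinD.
  by rewrite max_r ?subr_ge0 //; case: ltgtP ab => // ->; rewrite subrr.
- have -> : [set x : R | a < x < b /\ x <= c] = [set` `]a, c]].
    apply/seteqP; split=> x /=; rewrite in_itv /=; first by case=> /andP[-> _].
    by move=> /andP[-> xc]; split=> //; apply: le_lt_trans cb.
  rewrite lebesgue_measure_itv /= lte_fin EFinN -EFinD.
  case: ltP => ac; first by rewrite max_r // subr_ge0 ltW.
  by rewrite max_l // subr_le0.
Qed.

(** Here ]a, a + h[ is a cell and ]b, b + h[ its image under the translation by
    b - a.  The left side measures the x in the cell with x <= u whose image is
    at most v.  Both minima on the right are d truncated to [0, h], for
    d = u - a and d = v - b, and truncation commutes with the minimum. *)
Lemma initial_part_min (R : realType) (u v a b h : R) : 0 <= h ->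
  Num.max 0 (Num.min (a + h) (Num.min u (v + (a - b))) - a) =
  Num.min (Num.min u (a + h) - Num.min u a) (Num.min v (b + h) - Num.min v b).
Proof.
move=> h0.
have clip s d : Num.min s (d + h) - Num.min s d = Num.max 0 (Num.min h (s - d)).
  by minmax; lra.
rewrite !clip -max_minr minACA minxx !addr_minl.
by congr (Num.max _ (Num.min _ (Num.min _ _))); lra.
Qed.

Lemma trivIset_cells (R : realType) (N : nat) (A : 'I_N -> set R) :
  (forall i, A i `<=` [set x | grid R N i < x < grid R N i.+1]) ->
  trivIset setT A.
Proof.
move=> Ai i j _ _ [x [/Ai /= /andP[ix xi] /Ai /= /andP[jx xj]]].
have [ij|ji|/val_inj //] := ltngtP i j.
- by have := lt_trans xi (le_lt_trans (gridS_le R N ij) jx); rewrite ltxx.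
- by have := lt_trans xj (le_lt_trans (gridS_le R N ji) ix); rewrite ltxx.
Qed.

Definition grid_points (R : realType) (N : nat) : set R :=
  grid R N @` `I_N.+1.

Lemma cell_cover (R : realType) (N : nat) (x : R) : (0 < N)%N ->
  x \in `[0, 1] -> ~ grid_points N x ->
  exists i : 'I_N, grid R N i < x < grid R N i.+1.
Proof.
move=> N_gt0; rewrite in_itv /= => /andP[x0 x1] xgrid.
have NR : 0 < N%:R :> R by rewrite ltr0n.
have xN0 : 0 <= x * N%:R by rewrite mulr_ge0 // ltW.
have /andP[kx xk] := truncn_itv xN0.
set k := Num.truncn _ in kx xk.
have kN : (k <= N)%N.
  by rewrite -(ler_nat R) (le_trans kx) // ler_piMl // ltW.
have gx : grid R N k < x.
  rewrite lt_neqAle ler_pdivrMr // kx andbT.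
  by apply/eqP => kxE; apply: xgrid; exists k.
have kltN : (k < N)%N.
  rewrite ltn_neqAle kN andbT; apply/eqP => kNE.
  by move: gx; rewrite kNE /grid divff ?gt_eqF // ltNge x1.
by exists (Ordinal kltN); rewrite gx /= ltr_pdivlMr.
Qed.

Lemma grid_points_subset_null (R : realType) (N : nat) (A : set R) :
  measurable (A `&` grid_points N) /\
  lebesgue_measure (A `&` grid_points N) = 0.
Proof.
have Acount : countable (A `&` grid_points N).
  apply: sub_countable (subset_card_le (@subIsetr _ _ _)) _.
  by apply/finite_set_countable/finite_image/finite_II.
split; last exact: countable_lebesgue_measure0.
exact: countable_measurable.
Qed.

Lemma shuffle_copula_mass (R : realType) (N : nat) (p : 'S_N) (S : R -> R)
    (u v : R) : (0 < N)%N -> is_shuffle p S -> u \in `[0, 1] ->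
  shuffle_copula S u v = (shuffle_mass p u v)%:E.
Proof.
move=> N_gt0 [_ S_cell]; rewrite in_itv /= => /andP[u0 u1].
set A := [set x : R | x \in `[0, u] /\ S x <= v].
pose c (i : 'I_N) := Num.min u (v + (grid R N i - grid R N (p i))).
pose B (i : 'I_N) := [set x | grid R N i < x < grid R N i.+1 /\ x <= c i].
have cell_le i : grid R N i <= grid R N i.+1.
  by rewrite gridS lerDl ltW // invN_gt0.
have SE (i : 'I_N) x : grid R N i < x < grid R N i.+1 ->
    S x = x - (grid R N i - grid R N (p i)).
  by move=> xi; rewrite (S_cell i) ?mulrBl // in_itv.
have AE : A = \big[setU/set0]_(i < N) B i `|` (A `&` grid_points N).
  rewrite -bigcup_pred; apply/seteqP; split=> x /=.
  - move=> Ax; have [xg|xg] := pselect (grid_points N x); first by right.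
    left; case: Ax; rewrite in_itv /= => /andP[x0 xu] Sx.
    have [|i xi] := cell_cover N_gt0 _ xg.
      by rewrite in_itv /= x0 (le_trans xu).
    by exists i => //; split=> //; rewrite le_min xu -lerBlDr -SE.
  - case=> [[i _ [xi]]|[] //]; rewrite le_min -lerBlDr -SE // => /andP[xu Sx].
    split=> //; rewrite in_itv /= xu andbT; case/andP: xi => /ltW gx _.
    by apply: le_trans gx; rewrite /grid divr_ge0.
have mB i : measurable (B i).
  have -> : B i = [set` `]grid R N i, grid R N i.+1[] `&` [set` `]-oo, c i]].
    by apply/seteqP; split=> x /=; rewrite !in_itv.
  exact: measurableI.
have [mG G0] := grid_points_subset_null N A.
rewrite /shuffle_copula -/A AE.
rewrite measureU0 //; last first.
  by apply: (@bigsetU_measurable _ _ _ _ _ B) => i _; exact: mB.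
rewrite measure_bigsetU_ord //; last by apply: trivIset_cells => i x [].
rewrite /shuffle_mass -sumEFin; apply: eq_bigr => i _.
rewrite [LHS](measure_initial_part _ (cell_le i)) /cell_part !gridS.
by rewrite initial_part_min.
Qed.

Theorem proposition3p8 (R : realType) (N : nat) (p : 'S_N) (S : R -> R)
    (N_gt0 : (0 < N)%N) (N_even : ~~ odd N)
    (p_sym : symmetric_perm p) (p_bimon : bi_monotone p)
    (p_I0 : I_zero p = finset.set0)
    (S_shuffle : is_shuffle p S) :
  is_diagonal_copula (shuffle_copula S).
Proof.
exists (shuffle_diagonal p); first exact: shuffle_diagonalP.
move=> u v u01 v01.
by rewrite (shuffle_copula_mass v N_gt0 S_shuffle u01) shuffle_mass_diagonal.
Qed.
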